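(* Let $\mu$ be an even, log-concave probability measure on $\mathbb{R}$ with density. For any measurable functions $f,g:\mathbb{R}\to[0,\infty)$ and any non-decreasing measurable function $W:[0,\infty)\to(0,\infty)$ satisfying $$f(x)^{1/2}g(y)^{1/2}\le W\Big(\frac{|x-y|}{2}\Big)\qquad\text{for all }x,y\in\mathbb{R},$$ one has $$\Big(\int_{\mathbb{R}}f\,d\mu\Big)^{1/2}\Big(\int_{\mathbb{R}}g\,d\mu\Big)^{1/2}\le\int_{\mathbb{R}}W(|r|)\,d\mu(r).$$
   Context: An even log-concave probability measure on $\mathbb{R}$ with density is $d\mu(x)=\varphi(x)\,dx$ with $\varphi:\mathbb{R}\to[0,\infty)$ even and log-concave, i.e. $\varphi((1-t)x+ty)\ge\varphi(x)^{1-t}\varphi(y)^t$ for $x,y\in\mathbb{R}$, $t\in(0,1)$. Measurable means Borel measurable. *)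

(* Defs.v *)
From HB Require Import structures.
From mathcomp Require Import all_boot all_order all_algebra.
From mathcomp Require Import all_classical all_reals all_analysis.

Set Implicit Arguments.
Unset Strict Implicit.
Unset Printing Implicit Defensive.

Import Order.TTheory GRing.Theory Num.Theory.
Import numFieldNormedType.Exports.

Local Open Scope classical_set_scope.
Local Open Scope ring_scope.

(* For 0 < t < 1 we have 0 `^ t = 0, so zeros of phi are treated as usual. *)
Definition log_concave (R : realType) (phi : R -> R) : Prop :=
  forall x y t : R, 0 < t < 1 ->
    phi x `^ (1 - t) * phi y `^ t <= phi ((1 - t) * x + t * y).

Definition has_density (R : realType)
    (mu : probability (measurableTypeR R) R) (phi : R -> R) : Prop :=
  [/\ measurable_fun [set: R] phi,
      forall x, 0 <= phi x &
      forall A : set (measurableTypeR R), measurable A ->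
        mu A = (\int[lebesgue_measure]_(x in A) (phi x)%:E)%E].

Definition even_log_concave (R : realType)
    (mu : probability (measurableTypeR R) R) : Prop :=
  exists phi : R -> R,
    [/\ has_density mu phi, forall x, phi (- x) = phi x & log_concave phi].

(* Main.v *)
(** The theorem is the one-dimensional Prékopa–Leindler inequality with parameter
    1/2. As |x - y| / 2 = |(x + (-y)) / 2| and phi is even and log-concave, the
    functions F = f phi, G(y) = g(-y) phi(-y) and H(r) = W|r| phi(r) satisfy
    F(x) G(y) <= H((x + y) / 2)^2, hence int F * int G <= (int H)^2.

    Prékopa–Leindler itself: when F and G both have supremum 1, the superlevel
    sets at every height s < 1 are nonempty and the midpoints of {F > s} and
    {G > s} lie in {H > s}, so |{F > s}| + |{G > s}| <= 2 |{H > s}|; integrating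
    over s and using the AM-GM inequality gives the claim, and truncation and
    rescaling reduce to that case. *)
Require Import Defs.
From HB Require Import structures.
From mathcomp Require Import all_boot all_order all_algebra.
From mathcomp Require Import all_classical all_reals all_analysis.
From mathcomp Require Import measurable_realfun ring lra.
Set Implicit Arguments.
Unset Strict Implicit.
Unset Printing Implicit Defensive.
Import Order.TTheory GRing.Theory Num.Theory.
Import numFieldNormedType.Exports.
Local Open Scope classical_set_scope.
Local Open Scope ring_scope.

(** * Brunn-Minkowski inequality on the line, in midpoint form *)

Section midpoint_sets.
Context {R : realType}.
Local Notation leb := (@lebesgue_measure R).
Local Open Scope ereal_scope.

(** The set on the right is the half-size copy [(A + c) / 2]. Twice its measure is a measure in [A]
    that agrees with [leb] on half-open intervals, so uniqueness of Lebesgue measure applies. *)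
Lemma lebesgue_measure_dilation (c : R) (A : set R) :
  measurable A -> leb A = 2%:E * leb [set x | A (2 * x - c)%R].
Proof.
move=> mA; pose h (x : measurableTypeR R) : measurableTypeR R := (2 * x - c)%R.
have mh : measurable_fun [set: measurableTypeR R] h.
  by apply: measurable_funB => //; exact: measurable_funM.
pose h' : {mfun _ >-> _} := HB.pack h (isMeasurableFun.Build _ _ _ _ _ mh).
have -> : 2%:E * leb [set x | A (2 * x - c)%R] =
    mscale (2%:nng)%R (pushforward leb h') A by [].
apply: lebesgue_measure_unique mA => _ [[a b]] _ <-.
change (leb `]a, b]%classic = 2%:E * leb (h @^-1` `]a, b]%classic)).
have -> : h @^-1` `]a, b]%classic = `]((a + c) / 2)%R, ((b + c) / 2)%R]%classic.
  apply/seteqP; split => x /=; rewrite !in_itv/= /h => /andP[*];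
    apply/andP; split; lra.
rewrite !lebesgue_measure_itv/= !lte_fin.
have -> : ((a + c) / 2 < (b + c) / 2)%R = (a < b)%R.
  by apply/idP/idP => ?; lra.
case: ifPn => _; last by rewrite mule0.
by rewrite -!EFinD -EFinM; congr EFin; field.
Qed.

(* (A + b) / 2 lies to the left of m = (a + b) / 2 and (a + B) / 2 to its right,
   so the two half-size copies of A and B in C overlap at m only. *)
Lemma lebesgue_measure_midpoint_attained (A B C : set R) (a b : R) :
  measurable A -> measurable B -> measurable C -> A a -> B b ->
  (forall x, A x -> (x <= a)%R) -> (forall y, B y -> (b <= y)%R) ->
  (forall x y, A x -> B y -> C ((x + y) / 2)%R) ->
  leb A + leb B <= 2%:E * leb C.
Proof.
move=> mA mB mC Aa Bb Aub Blb ABC.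
pose m := ((a + b) / 2)%R; pose L : set R := `]-oo, m]%classic.
have mL : measurable L by exact: measurable_itv.
have mB' : measurable (B `\ b) by exact: measurableD.
have mpre c (D : set R) : measurable D ->
    measurable [set x : R | D (2 * x - c)%R].
  move=> mD.
  have mh : measurable_fun [set: R] (fun x : R => 2 * x - c)%R.
    by apply: measurable_funB => //; exact: measurable_funM.
  by rewrite -[X in measurable X]setTI; exact: mh.
(* Dropping the null point [b] from [B] removes [m] from the right-hand copy, which then lies in the
   complement of [L]. *)
have leB : leb B <= leb (B `\ b).
  rewrite -[X in leb X <= _](@setDUK _ [set b]); last by move=> _ ->.
  rewrite (le_trans (measureU2 _ _ _))//.
  by rewrite [X in X + _](lebesgue_measure_set1 b) add0e.
rewrite (le_trans (leeD (lexx _) leB))//.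
rewrite (lebesgue_measure_dilation b mA) (lebesgue_measure_dilation a mB').
rewrite -ge0_muleDr//; apply: lee_wpmul2l => //.
have -> : leb C = leb (C `\` L) + leb (C `&` L) by exact: measureDI.
rewrite addeC leeD//.
  apply: le_measure; rewrite ?inE; [exact: mpre|exact: measurableD|].
  move=> x /= [Bx xb]; split.
    by have := ABC _ _ Aa Bx; rewrite addrC subrK mulrC mulKf.
  have := Blb _ Bx; rewrite le_eqVlt => /orP[/eqP xE|bx].
    by exfalso; apply: xb.
  by rewrite /L/= in_itv/= /m; apply/negP; rewrite -ltNge; lra.
apply: le_measure; rewrite ?inE; [exact: mpre|exact: measurableI|].
move=> x /= Ax; split.
  by have := ABC _ _ Ax Bb; rewrite subrK mulrC mulKf.
by have := Aub _ Ax; rewrite /L/= in_itv/= /m; lra.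
Qed.

(** Any measurable [C] containing the midpoints is allowed, so no measurability of a Minkowski sum
    is at stake. If [A] were empty the midpoint condition would be vacuous and the bound could
    fail. *)
Lemma lebesgue_measure_midpoint (A B C : set R) :
  measurable A -> measurable B -> measurable C -> A !=set0 -> B !=set0 ->
  (forall x y, A x -> B y -> C ((x + y) / 2)%R) ->
  leb A + leb B <= 2%:E * leb C.
Proof.
move=> mA mB mC [a0 Aa0] [b0 Bb0] ABC.
(* By inner regularity it suffices to treat compact subsets, which have a maximum
   and a minimum; adjoining a0 and b0 keeps them nonempty. *)
have cpt_sup (K L : set R) : compact K -> compact L -> K `<=` A -> L `<=` B ->
    leb K + leb L <= 2%:E * leb C.
  move=> cK cL KA LB.
  pose K' := K `|` [set a0]; pose L' := L `|` [set b0].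
  have cK' : compact K' by apply: compactU => //; exact: compact_set1.
  have cL' : compact L' by apply: compactU => //; exact: compact_set1.
  have mK' := compact_measurable cK'; have mL' := compact_measurable cL'.
  have [||a aK' aub] := @compact_EVT_max _ _ id K' _ cK'.
  - by exists a0; right.
  - by apply: continuous_subspaceT => x.
  have [||b bL' blb] := @compact_EVT_min _ _ id L' _ cL'.
  - by exists b0; right.
  - by apply: continuous_subspaceT => x.
  have K'A : K' `<=` A by move=> x [/KA//|->].
  have L'B : L' `<=` B by move=> x [/LB//|->].
  apply: (@le_trans _ _ (leb K' + leb L')).
    apply: leeD; apply: le_measure; rewrite ?inE//.
    - exact: compact_measurable.
    - by move=> x; left.
    - exact: compact_measurable.
    - by move=> x; left.
  apply: (@lebesgue_measure_midpoint_attained _ _ _ a b) => //.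
  - by rewrite inE in aK'.
  - by rewrite inE in bL'.
  - by move=> x K'x; apply: aub; rewrite inE.
  - by move=> x L'x; apply: blb; rewrite inE.
  - by move=> x y /K'A Ax /L'B By; exact: ABC.
(* With [leb C] finite, the measures involved are finite and can be moved across the inequality. The
   supremum is then taken over [K] with [L] fixed, and afterwards over [L]; empty compact sets give
   the finiteness bounds. *)
have [Cfin|] := ltP (2%:E * leb C) +oo; last first.
  by rewrite leye_eq => /eqP ->; rewrite leey.
have fin K : 0 <= leb K -> leb K <= 2%:E * leb C -> leb K \is a fin_num.
  by move=> ? /le_lt_trans /(_ Cfin); rewrite ge0_fin_numE.
have finC : 2%:E * leb C \is a fin_num by rewrite ge0_fin_numE// mule_ge0.
have finL L : compact L -> L `<=` B -> leb L \is a fin_num.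
  move=> cL LB; apply: fin => //.
  have := @cpt_sup set0 L compact0 cL _ LB.
  by rewrite measure0 add0e; apply => x [].
have ALC L : compact L -> L `<=` B -> leb A + leb L <= 2%:E * leb C.
  move=> cL LB; rewrite -leeBrDr ?finL// [leLHS]lebesgue_regularity_inner_sup//.
  apply: ge_ereal_sup => _ [K [cK KA] <-].
  by rewrite leeBrDr ?finL//; exact: cpt_sup.
have finA : leb A \is a fin_num.
  apply: fin => //; have := @ALC set0 compact0; rewrite measure0 adde0.
  by apply => x [].
rewrite addeC -leeBrDr// [leLHS]lebesgue_regularity_inner_sup//.
apply: ge_ereal_sup => _ [L [cL LB] <-].
by rewrite leeBrDr// addeC; exact: ALC.
Qed.

End midpoint_sets.

(** * Layer-cake formula *)

Section layer_cake.
Local Open Scope ereal_scope.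
Context d (T : measurableType d) (R : realType).
Context (m : {sigma_finite_measure set T -> \bar R}) (f : T -> R).
Hypotheses (mf : measurable_fun [set: T] f) (f0 : forall x, (0 <= f x)%R).
Local Notation leb := (@lebesgue_measure R).

Let ind (p : T * measurableTypeR R) : \bar R := (\1_`[0%R, f p.1[ p.2)%:E.

Let mind : measurable_fun setT ind.
Proof.
apply/measurable_EFinP/measurable_indic.
rewrite [X in measurable X](_ : _ =
    (fun p : T * measurableTypeR R => (0 <= p.2)%R) @^-1` [set true] `&`
    (fun p : T * measurableTypeR R => (p.2 < f p.1)%R) @^-1` [set true]); last first.
  by apply/seteqP; split => p; rewrite /= in_itv/= => /andP.
apply: measurableI; rewrite -[X in measurable X]setTI.
  by apply: measurable_fun_ler.
by apply: measurable_fun_ltr => //; exact: measurableT_comp.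
Qed.

Let ind0 p : 0 <= ind p. Proof. by rewrite lee_fin. Qed.

Let ind_section s : (0 <= s)%R -> \int[m]_x ind (x, s) = m [set x | (s < f x)%R].
Proof.
move=> s0; have <- : \int[m]_x (\1_[set x | (s < f x)%R] x)%:E = m [set x | (s < f x)%R].
  rewrite integral_indic// ?setIT//.
  by rewrite -[X in measurable X]setTI; exact: measurable_fun_ltr.
apply: eq_integral => x _; rewrite /ind !indicE; congr ((_ : bool)%:R%:E).
by apply/idP/idP; rewrite !inE/= in_itv/= s0.
Qed.

(** By Tonelli the sections of [ind] have measurable integrals. For [s < 0] the section of [ind] is
    empty while the superlevel set is everything, hence the restriction to nonnegative heights. *)
Lemma measurable_fun_superlevel :
  measurable_fun (`[0%R, +oo[ : set R) (fun s => m [set x | (s < f x)%R]).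
Proof.
apply: (eq_measurable_fun (fun s => \int[m]_x ind (x, s))).
  by move=> s; rewrite inE/= in_itv/= andbT; exact: ind_section.
apply: measurable_funTS.
exact: (measurable_fun_fubini_tonelli_G (m1 := m) ind).
Qed.

(** Tonelli for the region under the graph of [f]: integrating out the height gives [f x],
    integrating out [x] gives the measure of a superlevel set. *)
Lemma ge0_integral_layer_cake :
  \int[m]_x (f x)%:E = \int[leb]_(s in `[0%R, +oo[) m [set x | (s < f x)%R].
Proof.
transitivity (\int[m]_x \int[leb]_s ind (x, s)).
  apply: eq_integral => x _.
  have -> : \int[leb]_s ind (x, s) = leb `[0%R, f x[%classic.
    rewrite -[in RHS](setIT `[0%R, f x[%classic).
    by rewrite -(integral_indic leb measurableT (measurable_itv `[0%R, f x[)).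
  rewrite lebesgue_measure_itv/= lte_fin.
  have := f0 x; rewrite le_eqVlt => /predU1P[<-|->]; first by rewrite ltxx.
  by rewrite oppr0 adde0.
transitivity (\int[leb]_s \int[m]_x ind (x, s)); first exact: fubini_tonelli.
rewrite [RHS]integral_mkcond/=.
apply: eq_integral => s _; rewrite patchE.
case: ifPn => [|sn]; rewrite ?inE/= ?in_itv/= ?andbT; first exact: ind_section.
apply: integral0_eq => x _; rewrite /ind indicE memNset//= in_itv/=.
by case/andP => s0 _; move: sn; rewrite notin_setE/= in_itv/= s0.
Qed.

End layer_cake.

(** * Integration against a measure with density *)

Section density.
Local Open Scope ereal_scope.
Context {R : realType}.
Local Notation leb := (@lebesgue_measure R).

(** The Radon-Nikodym derivative of [mu] and [phi] have the same integral over every measurable set,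
    so they agree almost everywhere, and the change of variables for the former carries over to
    [phi]. *)
Lemma ge0_integral_density (mu : probability (measurableTypeR R) R)
    (phi : R -> R) (f : R -> \bar R) : has_density mu phi ->
  measurable_fun [set: R] f -> (forall x, 0 <= f x) ->
  \int[mu]_x f x = \int[leb]_x (f x * (phi x)%:E).
Proof.
move=> [mphi phi0 muE] mf f0.
have mphiE D : measurable_fun (D : set R) (EFin \o phi).
  by apply/measurable_EFinP; exact: measurable_funTS.
have mumu : mu `<< leb.
  move=> N N0 A mA AN; rewrite [LHS]muE//.
  by apply: null_set_integral; [exact: mA|exact: mphiE|exact: N0].
have /(measurable_int _) mrn := Radon_Nikodym_SigmaFinite.f_integrable mumu.
rewrite -(Radon_Nikodym_SigmaFinite.change_of_variables mumu f0)//.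
apply: ge0_ae_eq_integral => //.
- exact: emeasurable_funM.
- exact: emeasurable_funM (mphiE _).
- by move=> x _; rewrite mule_ge0// Radon_Nikodym_SigmaFinite.f_ge0.
- by move=> x _; rewrite mule_ge0// lee_fin.
apply: ae_eqe_mul2l; apply: integral_ae_eq => //.
- exact: Radon_Nikodym_SigmaFinite.f_integrable.
- exact: mphiE.
- move=> E _ mE; rewrite -Radon_Nikodym_SigmaFinite.f_integral//.
  exact: muE.
Qed.

End density.

(** * Prékopa-Leindler inequality: normalized, bounded and general *)

Section prekopa_leindler.
Context {R : realType}.
Local Notation leb := (@lebesgue_measure R).
Implicit Types F G H : R -> R.
Local Open Scope ereal_scope.

Lemma prekopa_leindler_normalized F G H :
  measurable_fun [set: R] F -> measurable_fun [set: R] G ->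
  measurable_fun [set: R] H ->
  (forall x, (0 <= F x <= 1)%R) -> (forall x, (0 <= G x <= 1)%R) ->
  (forall x, (0 <= H x)%R) ->
  (forall t, (t < 1)%R -> exists x, (t < F x)%R) ->
  (forall t, (t < 1)%R -> exists x, (t < G x)%R) ->
  (forall x y, (F x * G y <= H ((x + y) / 2) ^+ 2)%R) ->
  \int[leb]_x (F x)%:E + \int[leb]_x (G x)%:E <= 2%:E * \int[leb]_x (H x)%:E.
Proof.
move=> mF mG mH F01 G01 H0 supF supG FGH.
have F0 x : (0 <= F x)%R by case/andP: (F01 x).
have G0 x : (0 <= G x)%R by case/andP: (G01 x).
have mlev (K : R -> R) s : measurable_fun [set: R] K ->
    measurable [set x | (s < K x)%R].
  by move=> mK; rewrite -[X in measurable X]setTI; exact: measurable_fun_ltr.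
rewrite !ge0_integral_layer_cake//.
rewrite -ge0_integralZl//; last exact: measurable_fun_superlevel.
rewrite -ge0_integralD//; [|exact: measurable_fun_superlevel..].
apply: ge0_le_integral => //.
- by move=> s _; rewrite adde_ge0.
- by apply: emeasurable_funD; exact: measurable_fun_superlevel.
- by apply: emeasurable_funM => //; exact: measurable_fun_superlevel.
move=> s; rewrite /= in_itv/= andbT => s0; have [s1|s1] := ltP s 1%R.
  apply: lebesgue_measure_midpoint.
  - exact: mlev.
  - exact: mlev.
  - exact: mlev.
  - by have [x] := supF _ s1; exists x.
  - by have [x] := supG _ s1; exists x.
  (* If [F x] and [G y] exceed [s >= 0], then [H ^+ 2] at the midpoint exceeds [s ^+ 2], so [H]
     exceeds [s] there. *)
  move=> x y /= sF sG; have := FGH x y.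
  apply: contraTT; rewrite -!leNgt -ltNge => Hs.
  have := H0 ((x + y) / 2)%R.
  by nra.
(* At heights [s >= 1] the superlevel sets of [F] and [G] are empty. *)
have lev0 (K : R -> R) : (forall x, (K x <= 1)%R) ->
    leb [set x | (s < K x)%R] = 0.
  move=> K1; rewrite [X in leb X](_ : _ = set0) ?measure0//.
  by rewrite -subset0 => x /=; rewrite ltNge (le_trans (K1 x)).
have F1 x : (F x <= 1)%R by case/andP: (F01 x).
have G1 x : (G x <= 1)%R by case/andP: (G01 x).
by rewrite (lev0 F)// (lev0 G)// adde0 mule_ge0.
Qed.

(** Dividing [F] and [G] by their suprema [a], [b] and [H] by [c = sqrt (a * b)] preserves the
    pointwise hypothesis and scales both sides of the conclusion by [a * b]. *)
Lemma prekopa_leindler_bounded F G H (M : R) :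
  measurable_fun [set: R] F -> measurable_fun [set: R] G ->
  measurable_fun [set: R] H ->
  (forall x, (0 <= F x <= M)%R) -> (forall x, (0 <= G x <= M)%R) ->
  (forall x, (0 <= H x)%R) ->
  (forall x y, (F x * G y <= H ((x + y) / 2) ^+ 2)%R) ->
  \int[leb]_x (F x)%:E * \int[leb]_x (G x)%:E <=
  \int[leb]_x (H x)%:E * \int[leb]_x (H x)%:E.
Proof.
move=> mF mG mH FM GM H0 FGH.
have I0 (K : R -> R) : (forall x, 0 <= K x)%R -> 0 <= \int[leb]_x (K x)%:E.
  by move=> K0; apply: integral_ge0 => x _; rewrite lee_fin.
have hs (K : R -> R) : (forall x, (0 <= K x <= M)%R) -> has_sup (range K).
  move=> KM; split; first by exists (K 0%R); exists 0%R.
  by exists M => _ [x _ <-]; case/andP: (KM x).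
have zero (K : R -> R) : (forall x, (0 <= K x <= M)%R) ->
    ~~ (0 < sup (range K))%R ->
    \int[leb]_x (K x)%:E = 0.
  move=> KM; rewrite -leNgt => sK; apply: integral0_eq => x _; congr EFin.
  apply/eqP; rewrite eq_le; have /andP[-> _] := KM x; rewrite andbT.
  apply: le_trans sK; apply: ub_le_sup; first exact: (hs K KM).2.
  by exists x.
have [a0|/(zero F FM) ->] := boolP (0 < sup (range F))%R; last first.
  by rewrite mul0e; apply: mule_ge0; exact: I0.
have [b0|/(zero G GM) ->] := boolP (0 < sup (range G))%R; last first.
  by rewrite mule0; apply: mule_ge0; exact: I0.
set a := sup _ in a0; set b := sup _ in b0.
pose c := Num.sqrt (a * b).
have c0 : (0 < c)%R by rewrite sqrtr_gt0 mulr_gt0.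
have cE : (c ^+ 2 = a * b)%R by rewrite sqr_sqrtr// ltW// mulr_gt0.
have scale (K : R -> R) k : (0 < k)%R -> measurable_fun [set: R] K ->
    (forall x, 0 <= K x)%R ->
    \int[leb]_x (K x)%:E = k%:E * \int[leb]_x (K x / k)%:E.
  move=> k0 mK K0; rewrite -ge0_integralZl//.
  - by apply: eq_integral => x _; rewrite -EFinM mulrC divfK// gt_eqF.
  - by apply/measurable_EFinP; exact: measurable_funM.
  - by move=> x _; rewrite lee_fin divr_ge0// ltW.
  - by rewrite lee_fin ltW.
have norm01 (K : R -> R) : (forall x, (0 <= K x <= M)%R) -> (0 < sup (range K))%R ->
    forall x, (0 <= K x / sup (range K) <= 1)%R.
  move=> KM k0 x; have /andP[Kx _] := KM x; rewrite divr_ge0 ?(ltW k0)//=.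
  rewrite ler_pdivrMr// mul1r; apply: ub_le_sup; first exact: (hs K KM).2.
  by exists x.
have supn (K : R -> R) : (forall x, (0 <= K x <= M)%R) -> (0 < sup (range K))%R ->
    forall t, (t < 1)%R -> exists x, (t < K x / sup (range K))%R.
  move=> KM k0 t t1.
  have tk : (t * sup (range K) < sup (range K))%R by rewrite gtr_pMl.
  have [_ [x _ <-] xP] := sup_gt (hs K KM).1 tk.
  by exists x; rewrite ltr_pdivlMr.
have F0 x : (0 <= F x)%R by case/andP: (FM x).
have G0 x : (0 <= G x)%R by case/andP: (GM x).
rewrite (scale F a)// (scale G b)// (scale H c)//.
have : \int[leb]_x (F x / a)%:E + \int[leb]_x (G x / b)%:E <=
    2%:E * \int[leb]_x (H x / c)%:E.
  apply: prekopa_leindler_normalized.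
  - exact: measurable_funM.
  - exact: measurable_funM.
  - exact: measurable_funM.
  - exact: norm01.
  - exact: norm01.
  - by move=> x; rewrite divr_ge0// ltW.
  - exact: supn.
  - exact: supn.
  move=> x y; rewrite expr_div_n cE mulf_div ler_wpM2r//.
  by rewrite invr_ge0 mulr_ge0// ltW.
have := I0 (fun x => F x / a)%R (fun x => divr_ge0 (F0 x) (ltW a0)).
have := I0 (fun x => G x / b)%R (fun x => divr_ge0 (G0 x) (ltW b0)).
have := I0 (fun x => H x / c)%R (fun x => divr_ge0 (H0 x) (ltW c0)).
(* An infinite integral of [H] makes the right side infinite; a finite one forces [p] and [q] to be
   finite through the bound on their sum. *)
move: (\int[leb]_x (F x / a)%:E) (\int[leb]_x (G x / b)%:E)
  (\int[leb]_x (H x / c)%:E) => p q [h||]// h0 q0 p0; last first.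
  by move=> _; rewrite !gt0_muley ?lte_fin// leey.
rewrite -EFinM.
move: p q p0 q0 => [p||] [q||]//; rewrite -?EFinM -?EFinD !lee_fin => p0 q0 pqh.
have -> : (a * p * (b * q) = c ^+ 2 * (p * q))%R by rewrite cE; ring.
have -> : (c * h * (c * h) = c ^+ 2 * (h * h))%R by ring.
rewrite ler_wpM2l ?sqr_ge0//.
(* AM-GM: 4 p q <= (p + q)^2 <= 4 h^2 *)
have := sqr_ge0 (p - q)%R.
nra.
Qed.

(** Truncating [F] and [G] at height [n] keeps the hypothesis with the same [H], and monotone
    convergence recovers the full integrals. *)
Lemma prekopa_leindler F G H :
  measurable_fun [set: R] F -> measurable_fun [set: R] G ->
  measurable_fun [set: R] H ->
  (forall x, (0 <= F x)%R) -> (forall x, (0 <= G x)%R) ->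
  (forall x, (0 <= H x)%R) ->
  (forall x y, (F x * G y <= H ((x + y) / 2) ^+ 2)%R) ->
  \int[leb]_x (F x)%:E * \int[leb]_x (G x)%:E <=
  \int[leb]_x (H x)%:E * \int[leb]_x (H x)%:E.
Proof.
move=> mF mG mH F0 G0 H0 FGH.
have I0 (K : R -> R) : (forall x, 0 <= K x)%R -> 0 <= \int[leb]_x (K x)%:E.
  by move=> K0; apply: integral_ge0 => x _; rewrite lee_fin.
pose tr (K : R -> R) (n : nat) x := Num.min (K x) n%:R.
have mtr (K : R -> R) n : measurable_fun [set: R] K -> measurable_fun [set: R] (tr K n).
  by move=> mK; exact: measurable_minr.
have tr0 (K : R -> R) n : (forall x, 0 <= K x)%R -> forall x, (0 <= tr K n x)%R.
  by move=> K0 x; rewrite le_min K0 ler0n.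
have cvg_tr (K : R -> R) : measurable_fun [set: R] K -> (forall x, 0 <= K x)%R ->
    \int[leb]_x (tr K n x)%:E @[n --> \oo] --> \int[leb]_x (K x)%:E.
  move=> mK K0.
  have -> : \int[leb]_x (K x)%:E = \int[leb]_x limn (fun n => (tr K n x)%:E).
    apply: eq_integral => x _; apply/esym/cvg_lim => //.
    apply: cvg_near_cst; near=> n; rewrite /tr min_l//.
    near: n; exact: nbhs_infty_ger.
  apply: cvg_monotone_convergence => //.
  - by move=> n; apply/measurable_EFinP; exact: mtr.
  - by move=> n x _; rewrite lee_fin tr0.
  - by move=> x _ m n mn; rewrite lee_fin /tr le_min2// ler_nat.
(* Zero integrals are treated apart because the limit of the product must avoid the form
   [0 * +oo]. *)
have [->|F_neq0] := eqVneq (\int[leb]_x (F x)%:E) 0.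
  by rewrite mul0e; apply: mule_ge0; exact: I0.
have [->|G_neq0] := eqVneq (\int[leb]_x (G x)%:E) 0.
  by rewrite mule0; apply: mule_ge0; exact: I0.
have FGcvg : \int[leb]_x (tr F n x)%:E * \int[leb]_x (tr G n x)%:E @[n --> \oo]
    --> \int[leb]_x (F x)%:E * \int[leb]_x (G x)%:E.
  apply: cvgeM; [|exact: cvg_tr..].
  by rewrite mule_defE (negbTE F_neq0) (negbTE G_neq0).
rewrite -(cvg_lim _ FGcvg)//; apply: lime_le; first exact: cvgP FGcvg.
apply: nearW => n; apply: (@prekopa_leindler_bounded _ _ _ n%:R).
- exact: mtr.
- exact: mtr.
- exact: mH.
- by move=> x; rewrite tr0//= ge_min lexx orbT.
- by move=> x; rewrite tr0//= ge_min lexx orbT.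
- exact: H0.
move=> x y; apply: le_trans (FGH x y).
by rewrite ler_pM ?tr0// ge_min lexx.
Unshelve. all: by end_near. Qed.

End prekopa_leindler.

(** * Reflection, and the inequality for even log-concave measures *)

Lemma ge0_integral_reflection (R : realType) (f : R -> \bar R) :
  measurable_fun [set: R] f -> (forall x, 0 <= f x)%E ->
  (\int[@lebesgue_measure R]_x f (- x)%R = \int[@lebesgue_measure R]_x f x)%E.
Proof.
move=> mf f0.
have mN : measurable_fun setT (-%R : measurableTypeR R -> measurableTypeR R).
  exact: oppr_measurable.
transitivity (\int[pushforward lebesgue_measure
    (-%R : measurableTypeR R -> measurableTypeR R)]_x f x)%E.
  by rewrite ge0_integral_pushforward// preimage_setT.
by apply: eq_measure_integral => A mA _; exact: lebesgue_measureN.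
Qed.

Theorem corollary6p9 (R : realType) (mu : probability (measurableTypeR R) R)
    (hmu : even_log_concave mu)
    (f g W : R -> R)
    (mf : measurable_fun [set: R] f) (f_ge0 : forall x, 0 <= f x)
    (mg : measurable_fun [set: R] g) (g_ge0 : forall x, 0 <= g x)
    (mW : measurable_fun (`[0, +oo[ : set R) W)
    (W_gt0 : forall r, 0 <= r -> 0 < W r)
    (W_nondecreasing : forall r s, 0 <= r -> r <= s -> W r <= W s)
    (hfgW : forall x y, f x `^ 2^-1 * g y `^ 2^-1 <= W (`|x - y| / 2)) :
  ((\int[mu]_x (f x)%:E) `^ 2^-1 * (\int[mu]_x (g x)%:E) `^ 2^-1
    <= \int[mu]_r (W `|r|)%:E)%E.
Proof.
case: hmu => phi [dphi phiN lcphi]; have [mphi phi0 _] := dphi.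
pose F x := f x * phi x.
pose G x := g (- x) * phi (- x).
pose H x := W `|x| * phi x.
have mN : measurable_fun [set: R] (-%R : R -> R) by exact: oppr_measurable.
(* [W] is measurable on [[0, +oo[] only, which contains the range of the norm. *)
have mWabs : measurable_fun [set: R] (fun r : R => W `|r|).
  have mabs : measurable_fun [set: R] (Num.norm : R -> R) by exact: normr_measurable.
  apply: (measurable_comp (measurable_itv `[0, +oo[) _ mW mabs).
  by move=> _ [x _ <-]; rewrite /= in_itv/= normr_ge0.
have mF : measurable_fun [set: R] F by exact: measurable_funM.
have mgphi : measurable_fun [set: R] (fun x => g x * phi x).
  exact: measurable_funM.
have mG : measurable_fun [set: R] G by exact: (measurableT_comp mgphi mN).
have mH : measurable_fun [set: R] H by exact: measurable_funM.
have F0 x : 0 <= F x by rewrite mulr_ge0.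
have G0 x : 0 <= G x by rewrite mulr_ge0.
have Wabs_ge0 x : 0 <= W `|x| by rewrite ltW// W_gt0.
have H0 x : 0 <= H x by rewrite mulr_ge0.
(* Squaring serves twice: for the hypothesis on [W] at [x] and [- y], and for log-concavity at
   [t = 1/2]. *)
have sq x y z : 0 <= x -> 0 <= y -> x `^ 2^-1 * y `^ 2^-1 <= z ->
    x * y <= z ^+ 2.
  move=> x0 y0; rewrite -powRM// powR12_sqrt ?mulr_ge0// => xyz.
  rewrite -[leLHS]sqr_sqrtr ?mulr_ge0// ler_sqr// nnegrE ?sqrtr_ge0//.
  exact: le_trans xyz.
have FGH x y : F x * G y <= H ((x + y) / 2) ^+ 2.
  have fgW : f x * g (- y) <= W `|(x + y) / 2| ^+ 2.
    apply: sq => //; rewrite normrM [`|2^-1|]ger0_norm//.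
    by have := hfgW x (- y); rewrite opprK.
  have phiphi : phi x * phi y <= phi ((x + y) / 2) ^+ 2.
    apply: sq => //; have := lcphi x y 2^-1.
    have -> : 1 - 2^-1 = 2^-1 :> R by field.
    by rewrite -mulrDr mulrC [_^-1 * _]mulrC; apply; apply/andP; split; lra.
  by rewrite /F /G phiN mulrACA /H exprMn ler_pM// mulr_ge0.
have intE (k : R -> R) : measurable_fun [set: R] k -> (forall x, 0 <= k x) ->
    (\int[mu]_x (k x)%:E = \int[lebesgue_measure]_x (k x * phi x)%:E)%E.
  move=> mk k0; rewrite (ge0_integral_density dphi)//.
  exact/measurable_EFinP.
have I0 (k : R -> R) : (forall x, 0 <= k x) ->
    (0 <= \int[@lebesgue_measure R]_x (k x)%:E)%E.
  by move=> k0; apply: integral_ge0 => x _; rewrite lee_fin.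
rewrite !intE//.
have <- : (\int[lebesgue_measure]_x (G x)%:E =
    \int[lebesgue_measure]_x (g x * phi x)%:E)%E.
  apply: (@ge0_integral_reflection _ (fun x => (g x * phi x)%:E)).
    exact/measurable_EFinP.
  by move=> x; rewrite lee_fin mulr_ge0.
have := prekopa_leindler mF mG mH F0 G0 H0 FGH.
rewrite -poweRM ?I0//.
have HH0 := I0 H H0.
move=> FGHH; apply: (@le_trans _ _ ((\int[lebesgue_measure]_x (H x)%:E *
    \int[lebesgue_measure]_x (H x)%:E) `^ 2^-1)%E).
  apply: gt0_ler_poweR => //.
  - by rewrite in_itv/= leey mule_ge0 ?I0.
  - by rewrite in_itv/= leey mule_ge0 ?I0.
rewrite poweRM ?I0//.
(* The product of the two square roots gives back the integral, also when it is [+oo]. *)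
move: HH0; rewrite /H; case: (integral _ _ _) => [h h0||//].
- by rewrite poweR_EFin powR12_sqrt// -EFinM -expr2 sqr_sqrtr.
- by rewrite poweRyr// mulyy.
Qed.
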